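(* Let $0<k<1$ and let $w$ be a real number such that $w/K$ is irrational. Let $\sigma$ be the linear functional on Laurent polynomials in $z$ defined by its moments $$c_n=\langle\sigma,z^n\rangle=\mathrm{cn}(wn),\qquad n=0,\pm1,\pm2,\dots$$ For $n=0,1,2,\dots$ let $\Phi_n^{(C)}(z)=\sum_{s=0}^n W_{ns}z^s$, where $$W_{ns}=(-1)^s\,\mathrm{dn}(w(n-s))\,E_s^n\quad\text{if } n \text{ is even},\qquad W_{ns}=(-1)^{s+1}\,\mathrm{cn}(w(n-s))\,E_s^n\quad\text{if } n\text{ is odd}.$$ Then $$\langle\sigma,\Phi_n^{(C)}(z)\rangle=\sum_{s=0}^n W_{ns}c_s=0,\qquad n=1,2,3,\dots$$
   Context: The functions $\mathrm{sn},\mathrm{cn},\mathrm{dn}$ are the Jacobi elliptic functions with modulus $k$, and $K=K(k)$ is the complete elliptic integral of the first kind. The elliptic binomial coefficients are $$E_0^n=1,\qquad E_j^n=\prod_{s=0}^{j-1}\frac{\mathrm{sn}(w(n-s))}{\mathrm{sn}(w(s+1))}\quad (0\le j\le n),$$ and $E_j^n=0$ otherwise. *)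

(* Defs.v *)
From HB Require Import structures.
From mathcomp Require Import all_boot all_order all_algebra.
From mathcomp Require Import complex finmap monalg.
From mathcomp Require Import all_classical all_reals all_analysis.

Set Implicit Arguments.
Unset Strict Implicit.
Unset Printing Implicit Defensive.

Import Order.TTheory GRing.Theory Num.Theory.

Local Open Scope classical_set_scope.
Local Open Scope complex_scope.
Local Open Scope ring_scope.

Section jacobi.
Context {R : realType}.
Implicit Types k u phi theta : R.

Definition ellipticF_integrand k theta : R :=
  (Num.sqrt (1 - k ^+ 2 * sin theta ^+ 2))^-1.

(* The oriented integral from 0 to phi of the integrand; it is the integral
   over a set that the library provides, hence the case distinction. *)
Definition ellipticF k phi : R :=
  if 0 <= phi
  then \int[lebesgue_measure]_(theta in `[0, phi]) ellipticF_integrand k theta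
  else - \int[lebesgue_measure]_(theta in `[phi, 0]) ellipticF_integrand k theta.

Definition ellipticK k : R := ellipticF k (pi / 2).

(* The amplitude: for 0 < k < 1 the map [ellipticF k] is an increasing
   bijection of the real line, and [jacobi_am k] is its inverse. *)
Definition jacobi_am k u : R := xget 0 [set phi | ellipticF k phi = u].

Definition sn k u : R := sin (jacobi_am k u).
Definition cn k u : R := cos (jacobi_am k u).
Definition dn k u : R := Num.sqrt (1 - k ^+ 2 * sn k u ^+ 2).

End jacobi.

(* Finitely supported families of complex coefficients indexed by the integer
   exponents. Only the vector space structure is needed. *)
Definition laurent (R : realType) := {malg R[i][int]}.

Section moments.
Context {R : realType}.

Definition zpow (n : int) : laurent R := << n >>.

(* The sum over the exponents n of f of [f@_n * c n]. *)
Definition moment_functional (c : int -> R[i]) : laurent R -> R[i] :=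
  mmap idfun c.

Lemma moment_functional_is_linear c : scalar (moment_functional c).
Proof.
move=> a f g; rewrite /moment_functional mmapD; congr (_ + _).
rewrite (mmapEw (msuppZ_le _ _)) mmapE mulr_sumr.
by apply: eq_bigr => n _; rewrite /= mcoeffZ mulrA.
Qed.

HB.instance Definition _ c :=
  GRing.isLinear.Build R[i] (laurent R) R[i] *%R (moment_functional c)
    (moment_functional_is_linear c).

Lemma moment_functional_zpow c n : moment_functional c (zpow n) = c n.
Proof. by rewrite /moment_functional mmapU mul1r. Qed.

End moments.

Section polynomials.
Context {R : realType}.
Variables k w : R.

Definition moment (n : int) : R := cn k (w * n%:~R).

Definition sigma : {scalar laurent R} :=
  moment_functional (fun n => (moment n)%:C).

Definition ebinom (n j : nat) : R :=
  if (j <= n)%N then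
    \prod_(s < j) (sn k (w * (n%:R - s%:R)) / sn k (w * s.+1%:R))
  else 0.

Definition W (n s : nat) : R :=
  if odd n then (-1) ^+ s.+1 * cn k (w * (n%:R - s%:R)) * ebinom n s
  else (-1) ^+ s * dn k (w * (n%:R - s%:R)) * ebinom n s.

Definition Phi (n : nat) : laurent R :=
  \sum_(s < n.+1) (W n s)%:C *: zpow s%:Z.

End polynomials.

(* Main.v *)
Require Import Defs.
From mathcomp Require Import all_boot all_order all_algebra.
From mathcomp Require Import complex finmap monalg.
From mathcomp Require Import all_classical all_reals all_analysis.
From mathcomp Require Import ring lra.

Import Order.TTheory GRing.Theory Num.Theory numFieldNormedType.Exports.

Local Open Scope complex_scope.
Local Open Scope ring_scope.

(** The first equality is linearity of [sigma]. The sum vanishes for a reason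
    that depends on the parity of [n].

    For odd [n], the elliptic binomial coefficients are symmetric
    ([ebinom_sym]), so the reflection [s -> n - s] preserves
    [cn (w (n - s)) * cn (w s) * ebinom n s] and changes the sign
    [(-1) ^ s]: the sum is its own opposite ([sum_odd]).

    For even [n], the reflection preserves the sign, and adding the two copies
    of the sum puts [P = cn u * dn v + dn u * cn v] in each term, with
    [u = w (n - s)] and [v = w s]. As [u + v = w n] does not depend on [s], the
    identity ([half_argument_ratio])
      [sn (u + v) * P = (sn u + sn v) * (cn (u + v) + dn (u + v))]
    says that [P] is, up to a common factor, [sn u + sn v]. But
    [ebinom n s * sn (w (n - s)) = ebinom n s.+1 * sn (w (s + 1))]
    ([ebinomS]), so [(-1) ^ s * ebinom n s * (sn u + sn v)] is the difference
    [G s - G s.+1] for [G s = (-1) ^ s * ebinom n s * sn (w s)]. The sum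
    telescopes to [G 0 - G n.+1], where [sn 0 = 0] and [ebinom n n.+1 = 0]
    ([W_moment_even], [sum_even]).

    Both arguments divide by values [sn (w n)] with [n > 0]. The zeros of [sn]
    are the integer multiples of [2 K] ([sn_eq0]), so the irrationality of
    [w / K] makes these values nonzero ([sn_lattice_neq0]).

    The identity follows from the addition formulas for [sn], [cn] and [dn].
    These come from the differential equations of the three functions: along a
    line [u + v = x], the right-hand side of each addition formula is a
    quotient [N / D] with [N' D = N D'], hence constant, and its value at
    [u = 0] is the function at [x]. The modulus is less than 1, so [D] never
    vanishes and no pole has to be crossed. The differential equations in turn
    say that the amplitude is the inverse of a primitive of
    [1 / sqrt (1 - k^2 sin^2)]. *)

(** * Auxiliary facts of real analysis *)

(** On both sides of 0 the oriented integral is, up to a constant, the integral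
    from one fixed lower bound [- A] with [A > |x|], to which the fundamental
    theorem of calculus applies. *)
Lemma is_derive_oriented_integral (R : realType) (f : R -> R) (x : R) :
  continuous f ->
  is_derive x 1 (fun y => if 0 <= y
    then \int[lebesgue_measure]_(t in `[0, y]%classic) f t
    else - \int[lebesgue_measure]_(t in `[y, 0]%classic) f t) (f x).
Proof.
move=> cf; set mu := lebesgue_measure; pose A : R := `|x| + 1.
have fi a b : mu.-integrable `[a, b]%classic (EFin \o f).
  apply: continuous_compact_integrable; first exact: segment_compact.
  exact: continuous_subspaceT.
pose G (y : R) : R := \int[mu]_(t in `[- A, y]%classic) f t.
have A0 : 0 < A by rewrite ltr_wpDl.
have /andP[Ax xA] : - A < x < A by rewrite -ltr_norml ltrDl.
have [dG G'] : derivable G x 1 /\ derive1 G x = f x.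
  apply: (@continuous_FTC1 _ f (BLeft (- A)) x A) => //.
  exact: cf.
have itv a b c : a <= b -> b <= c ->
    \int[mu]_(t in `[a, c]%classic) f t - \int[mu]_(t in `[a, b]%classic) f t
    = \int[mu]_(t in `[b, c]%classic) f t.
  move=> ab bc.
  rewrite (@Rintegral_itvB _ f (BLeft a) (BRight c) b (fi a c)) ?bnd_simp//.
  rewrite Rintegral_itv_obnd_cbnd//.
  by apply: integrableS (fi b c) => //; apply: subset_itvr; rewrite bnd_simp.
apply: (@near_eq_is_derive _ _ _ (fun y => G y - G 0)).
  near=> y.
  have Ay : - A <= y by near: y; apply: cvgr_ge Ax; exact: cvg_id.
  case: leP => y0; first by rewrite /G itv// oppr_le0 ltW.
  by rewrite -(itv (- A) y 0)// ?ltW// opprB.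
rewrite -[f x]subr0; apply: is_deriveB.
by split => //; rewrite -derive1E.
Unshelve. all: by end_near. Qed.

Lemma is_derive_reflect (R : realType) (f : R -> R) (f' x u : R) :
  is_derive (x - u) 1 f f' -> is_derive u 1 (fun t => f (x - t)) (- f').
Proof.
move=> df; have dr : is_derive u 1 (fun t => x - t) (-1).
  by apply: is_derive_eq; rewrite add0r mul1r.
by rewrite -mulrN1; exact: (@is_derive1_comp R f (fun t => x - t) u _ _ df dr).
Qed.

Lemma quotient_const (R : realType) (N D N' D' : R -> R) (a b : R) :
  (forall t : R, is_derive t 1 N (N' t)) ->
  (forall t : R, is_derive t 1 D (D' t)) ->
  (forall t, D t != 0) -> (forall t, N' t * D t = N t * D' t) ->
  N a / D a = N b / D b.
Proof.
move=> dN dD D0 ND.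
apply: (@is_derive_0_is_cst _ (fun t => N t * (D t)^-1)) => t.
have dV := is_deriveV (D0 t) (dD t).
have dNt := dN t.
apply: is_derive_eq; rewrite /GRing.scale/=.
have Dt := D0 t; have := ND t.
move: (N t) (D t) (N' t) (D' t) Dt => n d n' d' d0 e.
have -> : n * (- d ^- 2 * d') + d^-1 * n' = (n' * d - n * d') / d ^+ 2 by field.
by rewrite e subrr mul0r.
Qed.

Lemma quasi_periodicz (V W : zmodType) (g : V -> W) (p : V) (c : W) :
  (forall x, g (x + p) = g x + c) ->
  forall (j : int) x, g (x + p *~ j) = g x + c *~ j.
Proof.
move=> gp; have gpn (n : nat) x : g (x + p *+ n) = g x + c *+ n.
  elim: n => [|n IH]; first by rewrite !mulr0n !addr0.
  by rewrite !mulrSr !addrA gp IH.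
case=> n x; first by rewrite -!pmulrn gpn.
by rewrite !NegzE !mulrNz -!pmulrn -[in RHS](subrK (p *+ n.+1) x) gpn addrK.
Qed.

(** [sin ^ 2] has period [pi], which brings [t] into [[0, pi[], where 0 is the
    only zero. *)
Lemma sin_eq0_pi (R : realType) (t : R) :
  sin t = 0 -> exists j : int, t = pi *~ j.
Proof.
move=> st; exists (Num.floor (t / pi)); set j := Num.floor _.
have p0 := pi_gt0 R.
have sp (x : R) : sin (x + pi) ^+ 2 = sin x ^+ 2 + 0.
  by rewrite sinDpi sqrrN addr0.
have := quasi_periodicz _ _ _ _ _ sp j (t - pi *~ j).
rewrite subrK st expr0n mul0rz addr0 => /esym/eqP.
rewrite sqrf_eq0 => /eqP sr.
have r0 : 0 <= t - pi *~ j.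
  by rewrite subr_ge0 -mulrzl -ler_pdivlMr// floor_le_tmp.
have r1 : t - pi *~ j < pi.
  rewrite ltrBlDl -mulrzl -[X in _ + X]mul1r -mulrDl -ltr_pdivrMr//.
  by rewrite -[1]/(1%:~R) -intrD floorD1_gt.
move: r0; rewrite le_eqVlt => /predU1P[/esym/eqP|r0].
  by rewrite subr_eq0 => /eqP.
by have := @sin_gt0_pi R _ (introT andP (conj r0 r1)); rewrite sr ltxx.
Qed.

Section jacobi.
Variables (R : realType) (k : R).
Hypotheses (hk0 : 0 < k) (hk1 : k < 1).
Implicit Types t u v x : R.

(** * The incomplete elliptic integral and its inverse *)

Lemma sqr_modulus_lt1 : k ^+ 2 < 1. Proof. by rewrite expr_lt1 ?ltW. Qed.

Lemma sin2_le1 t : sin t ^+ 2 <= 1.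
Proof. by rewrite sin2cos2 gerBl sqr_ge0. Qed.

Lemma delta_gt0 t : 0 < 1 - k ^+ 2 * sin t ^+ 2.
Proof.
rewrite subr_gt0 (le_lt_trans _ sqr_modulus_lt1)//.
by rewrite ler_piMr ?sqr_ge0 ?sin2_le1.
Qed.

Lemma ellipticF_integrand_ge1 t : 1 <= ellipticF_integrand k t.
Proof.
rewrite /ellipticF_integrand invf_ge1 ?sqrtr_gt0 ?delta_gt0//.
by rewrite -[leRHS]sqrtr1 ler_wsqrtr// gerBl mulr_ge0// sqr_ge0.
Qed.

Lemma continuous_ellipticF_integrand : continuous (ellipticF_integrand k).
Proof.
have cq : continuous (fun t : R => 1 - k ^+ 2 * sin t ^+ 2).
  move=> t; apply: cvgB; first exact: cvg_cst.
  apply: cvgM; first exact: cvg_cst.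
  exact: (cvgM (@continuous_sin R t) (@continuous_sin R t)).
move=> t; apply: cvgV; first by rewrite gt_eqF// sqrtr_gt0 delta_gt0.
exact: (@continuous_comp R R R _ Num.sqrt t (cq t) (@sqrt_continuous R _)).
Qed.

Lemma is_derive_ellipticF t :
  is_derive t 1 (ellipticF k) (ellipticF_integrand k t).
Proof. by apply/is_derive_oriented_integral/continuous_ellipticF_integrand. Qed.

Lemma continuous_ellipticF : continuous (ellipticF k).
Proof.
move=> t; apply/differentiable_continuous/derivable1_diffP.
by case: (is_derive_ellipticF t).
Qed.

Lemma ellipticF0 : ellipticF k 0 = 0.
Proof. by rewrite /ellipticF lexx set_itv1 Rintegral_set1. Qed.

(** The integrand is at least 1, so the integral grows at least linearly. It is
    therefore injective, and unbounded on both sides. *)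
Lemma ellipticF_expansive a b :
  a <= b -> b - a <= ellipticF k b - ellipticF k a.
Proof.
move=> ab; have [|c _ ->] := @MVT_segment _ (ellipticF k) _ a b ab
  (fun t _ => is_derive_ellipticF t).
  exact/continuous_subspaceT/continuous_ellipticF.
by rewrite ler_peMl ?subr_ge0// ellipticF_integrand_ge1.
Qed.

Lemma ellipticF_inj : injective (ellipticF k).
Proof.
move=> a b ab; wlog le_ab : a b ab / a <= b.
  by move=> H; case/orP: (le_total a b) => ?; [|apply: esym]; apply: H.
have := ellipticF_expansive _ _ le_ab; rewrite ab subrr subr_le0 => le_ba.
by apply/eqP; rewrite eq_le le_ab.
Qed.

(** The defining choice of the amplitude succeeds: the values of the integral at
    [- |u|] and [|u|] enclose [u], which the intermediate value theorem then
    attains. *)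
Lemma jacobi_amK : cancel (jacobi_am k) (ellipticF k).
Proof.
move=> u; suff [t tu] : exists t, ellipticF k t = u.
  by rewrite /jacobi_am; case: xgetP => // /(_ t).
have [t _ tu] : exists2 c, c \in `[- `|u|, `|u|] & ellipticF k c = u.
  apply: IVT; rewrite ?ge0_cp//.
    exact/continuous_subspaceT/continuous_ellipticF.
  have hp := ellipticF_expansive _ _ (normr_ge0 u).
  have hn : 0 - (- `|u|) <= ellipticF k 0 - ellipticF k (- `|u|).
    by apply: ellipticF_expansive; rewrite oppr_le0.
  move: hp hn; rewrite ellipticF0 !subr0 sub0r opprK sub0r lerNr => hp hn.
  rewrite ge_min le_max (le_trans hn)/= ?(le_trans _ hp) ?orbT//.
  - exact: ler_norm.
  - by rewrite lerNl -normrN ler_norm.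
by exists t.
Qed.

Lemma ellipticFK : cancel (ellipticF k) (jacobi_am k).
Proof. by move=> t; apply: ellipticF_inj; rewrite jacobi_amK. Qed.

Lemma jacobi_am0 : jacobi_am k 0 = 0.
Proof. by rewrite -{1}ellipticF0 ellipticFK. Qed.

Lemma is_derive_jacobi_am u : is_derive u 1 (jacobi_am k) (dn k u).
Proof.
rewrite -{1}(jacobi_amK u).
have -> : dn k u = (ellipticF_integrand k (jacobi_am k u))^-1.
  by rewrite /ellipticF_integrand invrK.
apply: is_derive_inverse.
- by near=> t; rewrite ellipticFK.
- by near=> t; exact: continuous_ellipticF.
- exact: is_derive_ellipticF.
- by rewrite gt_eqF// (lt_le_trans ltr01)// ellipticF_integrand_ge1.
Unshelve. all: by end_near. Qed.

(** * Differential equations of the Jacobi functions *)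

Lemma sn0 : sn k 0 = 0. Proof. by rewrite /sn jacobi_am0 sin0. Qed.

Lemma cn0 : cn k 0 = 1. Proof. by rewrite /cn jacobi_am0 cos0. Qed.

Lemma dn0 : dn k 0 = 1.
Proof. by rewrite /dn sn0 expr0n mulr0 subr0 sqrtr1. Qed.

Lemma cn_sqr u : cn k u ^+ 2 = 1 - sn k u ^+ 2.
Proof. exact: cos2sin2. Qed.

Lemma dn_sqr u : dn k u ^+ 2 = 1 - k ^+ 2 * sn k u ^+ 2.
Proof. by rewrite sqr_sqrtr// ltW// delta_gt0. Qed.

Lemma dn_neq0 u : dn k u != 0.
Proof. by rewrite gt_eqF// sqrtr_gt0 delta_gt0. Qed.

Lemma is_derive_sn u : is_derive u 1 (sn k) (cn k u * dn k u).
Proof.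
by apply: (is_derive1_comp (is_derive_sin _)); exact: is_derive_jacobi_am.
Qed.

Lemma is_derive_cn u : is_derive u 1 (cn k) (- (sn k u * dn k u)).
Proof.
rewrite -mulNr; apply: (is_derive1_comp (is_derive_cos _)).
exact: is_derive_jacobi_am.
Qed.

Lemma is_derive_dn u : is_derive u 1 (dn k) (- (k ^+ 2 * sn k u * cn k u)).
Proof.
have dsn := is_derive_sn u.
have dsq : is_derive u 1 (fun t => 1 - k ^+ 2 * sn k t ^+ 2)
    (- (2 * k ^+ 2 * sn k u * cn k u * dn k u)).
  by apply: is_derive_eq; rewrite /= /GRing.scale/=; ring.
have dsqrt := is_derive1_sqrt (delta_gt0 (jacobi_am k u)).
have := @is_derive1_comp R Num.sqrt (fun t => 1 - k ^+ 2 * sn k t ^+ 2) u _ _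
  dsqrt dsq.
move=> /(@is_derive_eq _ _ _ _ _ _ _ _); apply.
by rewrite -/(dn k u); have := dn_neq0 u => ?; field.
Qed.

(** * Addition formulas *)

Definition add_den u v := 1 - k ^+ 2 * sn k u ^+ 2 * sn k v ^+ 2.

Lemma add_den_neq0 u v : add_den u v != 0.
Proof.
rewrite gt_eqF// subr_gt0 (le_lt_trans _ sqr_modulus_lt1)//.
rewrite -mulrA ler_piMr ?sqr_ge0//.
by rewrite mulr_ile1 ?sqr_ge0 ?sin2_le1.
Qed.

(** The common part of the three addition formulas. The factor of [N t] in the
    hypothesis is the derivative of [add_den t (x - t)], so the hypothesis says
    that the quotient of [N t] by [add_den t (x - t)] has derivative 0; the
    denominator is 1 at [t = 0]. *)
Lemma addition_const (N N' : R -> R) x u :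
  (forall t : R, is_derive t 1 N (N' t)) ->
  (forall t, N' t * add_den t (x - t) =
     N t * (2 * k ^+ 2 * sn k t * sn k (x - t)
       * (sn k t * cn k (x - t) * dn k (x - t)
          - cn k t * dn k t * sn k (x - t)))) ->
  N u = N 0 * add_den u (x - u).
Proof.
move=> dN ND.
have dD t : is_derive (t : R) 1 (fun t => add_den t (x - t))
   (2 * k ^+ 2 * sn k t * sn k (x - t)
       * (sn k t * cn k (x - t) * dn k (x - t)
          - cn k t * dn k t * sn k (x - t))).
  have ds := is_derive_sn t.
  have dr := is_derive_reflect _ _ _ x _ (is_derive_sn (x - t)).
  by rewrite /add_den; apply: is_derive_eq; rewrite /GRing.scale/=; ring.
have := quotient_const _ _ _ _ _ u 0 dN dD (fun t => add_den_neq0 _ _) ND.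
rewrite {2}/add_den sn0 expr0n mulr0 mul0r subr0 divr1 => <-.
by rewrite divfK// add_den_neq0.
Qed.

(** Supplies to the inference of derivatives those of the Jacobi functions at
    [u] and, as functions of [u], at [x - u]. *)
Ltac jacobi_derivatives u x :=
  have ? := is_derive_sn u;
  have ? := is_derive_cn u;
  have ? := is_derive_dn u;
  have ? := is_derive_reflect _ _ _ x _ (is_derive_sn (x - u));
  have ? := is_derive_reflect _ _ _ x _ (is_derive_cn (x - u));
  have ? := is_derive_reflect _ _ _ x _ (is_derive_dn (x - u)).

(** Decides polynomial identities in the Jacobi functions at [u] and [v] modulo
    the expressions of [cn ^ 2] and [dn ^ 2] by [sn ^ 2]. *)
Ltac jacobi_ring u v :=
  have := cn_sqr u; have := cn_sqr v; have := dn_sqr u; have := dn_sqr v;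
  move: (sn k u) (cn k u) (dn k u) (sn k v) (cn k v) (dn k v);
  let e1 := fresh in let e2 := fresh in let e3 := fresh in let e4 := fresh in
  move=> ? ? ? ? ? ? e1 e2 e3 e4; ring: e1 e2 e3 e4.

Lemma sn_add u v : sn k (u + v) * add_den u v =
  sn k u * cn k v * dn k v + sn k v * cn k u * dn k u.
Proof.
rewrite -{2 3 4 5}[v](addKr u) [- u + _]addrC; move: (u + v) => x.
pose N t := sn k t * cn k (x - t) * dn k (x - t)
            + sn k (x - t) * cn k t * dn k t.
have N0 : N 0 = sn k x by rewrite /N subr0 sn0 cn0 dn0; ring.
transitivity (N 0 * add_den u (x - u)); first by rewrite N0.
apply/esym/(addition_const N) => t.
  by jacobi_derivatives t x; rewrite /N; apply: is_derive_eq.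
by rewrite /GRing.scale/= /N /add_den; jacobi_ring t (x - t).
Qed.

Lemma cn_add u v : cn k (u + v) * add_den u v =
  cn k u * cn k v - sn k u * sn k v * dn k u * dn k v.
Proof.
rewrite -{2 3 4 5}[v](addKr u) [- u + _]addrC; move: (u + v) => x.
pose N t := cn k t * cn k (x - t)
            - sn k t * sn k (x - t) * dn k t * dn k (x - t).
have N0 : N 0 = cn k x by rewrite /N subr0 sn0 cn0 dn0; ring.
transitivity (N 0 * add_den u (x - u)); first by rewrite N0.
apply/esym/(addition_const N) => t.
  by jacobi_derivatives t x; rewrite /N; apply: is_derive_eq.
by rewrite /GRing.scale/= /N /add_den; jacobi_ring t (x - t).
Qed.

Lemma dn_add u v : dn k (u + v) * add_den u v =
  dn k u * dn k v - k ^+ 2 * sn k u * sn k v * cn k u * cn k v.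
Proof.
rewrite -{2 3 4 5}[v](addKr u) [- u + _]addrC; move: (u + v) => x.
pose N t := dn k t * dn k (x - t)
            - k ^+ 2 * sn k t * sn k (x - t) * cn k t * cn k (x - t).
have N0 : N 0 = dn k x by rewrite /N subr0 sn0 cn0 dn0; ring.
transitivity (N 0 * add_den u (x - u)); first by rewrite N0.
apply/esym/(addition_const N) => t.
  by jacobi_derivatives t x; rewrite /N; apply: is_derive_eq.
by rewrite /GRing.scale/= /N /add_den; jacobi_ring t (x - t).
Qed.

(** The ratio of [cn u * dn v + dn u * cn v] to [sn u + sn v] depends only on
    [u + v]: with [a = (u + v) / 2] it is [cn a * dn a / sn a]. Its value at
    [v = 0] gives the form below, in which no half argument occurs. *)
Lemma half_argument_ratio u v :
  sn k (u + v) * (cn k u * dn k v + dn k u * cn k v) =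
  (sn k u + sn k v) * (cn k (u + v) + dn k (u + v)).
Proof.
apply: (mulIf (add_den_neq0 u v)).
rewrite mulrAC sn_add -[RHS]mulrA [(_ + dn k (u + v)) * _]mulrDl cn_add dn_add.
by jacobi_ring u v.
Qed.

(** * Zeros of the elliptic sine *)

(** By the periodicity and the parity of the integrand, [F (t + pi) - F t] and
    [F (pi - t) + F t] are constant; comparing the values at 0 and [pi / 2]
    shows that both constants are [F pi = 2 K]. *)
Lemma ellipticF_add_pi t :
  ellipticF k (t + pi) = ellipticF k t + ellipticK k *+ 2.
Proof.
have fpi s : ellipticF_integrand k (s + pi) = ellipticF_integrand k s.
  by rewrite /ellipticF_integrand sinDpi sqrrN.
have shift : ellipticF k (t + pi) - ellipticF k t = ellipticF k pi.
  have := @is_derive_0_is_cst R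
    (fun s => ellipticF k (s + pi) - ellipticF k s) t 0.
  rewrite add0r ellipticF0 subr0; apply=> s.
  have d1 := is_derive_ellipticF s.
  have d2 : is_derive s 1 (fun s => ellipticF k (s + pi))
      (ellipticF_integrand k s).
    rewrite -fpi; have d2 := is_derive_ellipticF (s + pi).
    have dr : is_derive s 1 (fun s : R => s + pi) 1.
      by apply: is_derive_eq; rewrite ?addr0.
    rewrite -[ellipticF_integrand _ _]mulr1.
    exact: (@is_derive1_comp R (ellipticF k) (fun s => s + pi) s _ _ d2 dr).
  by apply: is_derive_eq; rewrite subrr.
have reflect : ellipticF k pi = ellipticK k *+ 2.
  have := @is_derive_0_is_cst R
    (fun s => ellipticF k (pi - s) + ellipticF k s) 0 (pi / 2).
  have -> : pi - pi / 2 = pi / 2 :> R by field.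
  rewrite subr0 ellipticF0 addr0 -mulr2n; apply=> s.
  have d1 := is_derive_ellipticF s.
  have d2 := is_derive_reflect _ _ _ pi s (is_derive_ellipticF (pi - s)).
  apply: is_derive_eq.
  by rewrite [pi - s]addrC fpi /ellipticF_integrand sinN sqrrN addNr.
by rewrite -reflect -shift subrKC.
Qed.

Lemma sn_eq0 u : sn k u = 0 -> exists j : int, u = (ellipticK k *+ 2) *~ j.
Proof.
move=> /sin_eq0_pi[j]; rewrite -{2}(jacobi_amK u) => ->; exists j.
have := quasi_periodicz _ _ _ _ _ ellipticF_add_pi j 0.
by rewrite ellipticF0 !add0r.
Qed.

Variable w : R.

Lemma sn_lattice_neq0 n : irrational (w / ellipticK k) -> (0 < n)%N ->
  sn k (w * n%:R) != 0.
Proof.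
move=> hw n0; apply/eqP => /sn_eq0[j wn]; apply: hw.
(* If K = 0, then w / K is 0 by convention, hence rational. *)
apply/rationalP; have [K0|K0] := eqVneq (ellipticK k) 0.
  by exists 0, 1; rewrite K0 invr0 mulr0 mul0r.
exists (j *+ 2), n; have nR : n%:R != 0 :> R by rewrite pnatr_eq0 -lt0n.
by apply/eqP; rewrite eqr_div// wn -mulrzl mulrnAr rmorphMn mulrnAl.
Qed.

(** * Elliptic binomial coefficients *)

Local Notation a j := (sn k (w * j%:R)).

Lemma ebinomE n j : (j <= n)%N ->
  ebinom k w n j = \prod_(s < j) (a (n - s) / a s.+1).
Proof.
move=> jn; rewrite /ebinom jn; apply: eq_bigr => s _.
by rewrite natrB// ltnW// (leq_trans (ltn_ord s)).
Qed.

Hypothesis a_neq0 : forall n, (0 < n)%N -> sn k (w * n%:R) != 0.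

Lemma ebinomS n j : (j <= n)%N ->
  ebinom k w n j.+1 * sn k (w * j.+1%:R)
  = ebinom k w n j * sn k (w * (n - j)%:R).
Proof.
(* At j = n both sides vanish: on the right because sn 0 = 0. *)
rewrite leq_eqVlt => /predU1P[->|jn].
  by rewrite /ebinom ltnn mul0r subnn mulr0 sn0 mulr0.
rewrite (ebinomE _ _ jn) (ebinomE _ _ (ltnW jn)) big_ord_recr/= -mulrA.
by congr (_ * _); rewrite divfK ?a_neq0.
Qed.

(** [P] stands for the elliptic factorial, up to a constant factor. *)
Lemma ebinom_factorial (P : nat -> R) n j :
  (forall m, P m.+1 = P m * a m.+1) -> (j <= n)%N ->
  ebinom k w n j * P j * P (n - j)%N = P 0%N * P n.
Proof.
move=> PS; elim: j => [|j IH] jn.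
  by rewrite ebinomE// big_ord0 mul1r subn0.
rewrite -(IH (ltnW jn)) PS -(subnSK jn) PS subnSK//.
have := ebinomS _ _ (ltnW jn).
move: (a j.+1) (a (n - j)%N) => x y.
move: (ebinom k w n j.+1) (ebinom k w n j) (P j) (P (n - j.+1)%N).
move=> E1 E p q e.
by transitivity (E1 * x * (p * q)); [ring | rewrite e; ring].
Qed.

Lemma ebinom_sym n j : (j <= n)%N -> ebinom k w n (n - j) = ebinom k w n j.
Proof.
move=> jn; pose P m : R := \prod_(i < m) a i.+1.
have PS m : P m.+1 = P m * a m.+1 by rewrite /P big_ord_recr.
have P0 m : P m != 0 by apply/prodf_neq0 => i _; exact: a_neq0.
apply: (mulIf (P0 j)); apply: (mulIf (P0 (n - j)%N)).
rewrite (ebinom_factorial _ _ _ PS jn).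
by rewrite mulrAC -(ebinom_factorial _ _ _ PS (leq_subr j n)) subKn.
Qed.

(** * Vanishing of the sums *)

Lemma W_moment_odd n s : odd n -> (s <= n)%N ->
  W k w n (n - s) * moment k w (n - s)%N = - (W k w n s * moment k w s).
Proof.
move=> on le_sn; rewrite /W on ebinom_sym// /moment -!pmulrn.
rewrite -!natrB ?leq_subr// subKn// exprS [in RHS]exprS -signr_odd oddB// on.
by rewrite -[in RHS]signr_odd; case: (odd s) => /=; ring.
Qed.

Lemma sum_odd n : odd n -> \sum_(s < n.+1) W k w n s * moment k w s%:Z = 0.
Proof.
move=> on; set S := \sum_(_ < _) _.
have SN : S = - S.
  rewrite /S [LHS](reindex_inj rev_ord_inj)/= -sumrN; apply: eq_bigr => s _.
  by rewrite subSS W_moment_odd// -ltnS.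
by move: SN; lra.
Qed.

(** The terms of index [s] and [n - s] together, multiplied by [sn (w n)], form
    a difference of consecutive values of one sequence: replace
    [cn u * dn v + dn u * cn v] by the help of [half_argument_ratio], and then
    shift the index in the summand with [sn (w (n - s))] by [ebinomS]. *)
Lemma W_moment_even n s : ~~ odd n -> (s <= n)%N ->
  sn k (w * n%:R) *
    (W k w n s * moment k w s + W k w n (n - s) * moment k w (n - s)%N) =
  (cn k (w * n%:R) + dn k (w * n%:R)) *
  ((-1) ^+ s * ebinom k w n s * sn k (w * s%:R)
   - (-1) ^+ s.+1 * ebinom k w n s.+1 * sn k (w * s.+1%:R)).
Proof.
move=> en le_sn; rewrite -[_ * ebinom _ _ _ s.+1 * _]mulrA ebinomS//.
rewrite /W (negbTE en) ebinom_sym// /moment -!pmulrn.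
rewrite -!natrB ?leq_subr// subKn//.
have sgn : (-1) ^+ (n - s) = (-1) ^+ s :> R.
  by rewrite -signr_odd oddB// (negbTE en) signr_odd.
have := half_argument_ratio (w * (n - s)%:R) (w * s%:R).
rewrite -mulrDr -natrD subnK// sgn exprS => H.
rewrite mulN1r mulNr opprK.
transitivity ((-1) ^+ s * ebinom k w n s * (sn k (w * n%:R) *
   (cn k (w * (n - s)%:R) * dn k (w * s%:R)
    + dn k (w * (n - s)%:R) * cn k (w * s%:R)))).
  by ring.
by rewrite H; ring.
Qed.

Lemma sum_even n : ~~ odd n -> (0 < n)%N ->
  \sum_(s < n.+1) W k w n s * moment k w s%:Z = 0.
Proof.
move=> en n0; set S := \sum_(_ < _) _.
suff : sn k (w * n%:R) * (S + S) = 0.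
  by move=> /eqP; rewrite mulf_eq0 (negbTE (a_neq0 _ n0))/= => /eqP; lra.
rewrite {2}/S [X in _ + X](reindex_inj rev_ord_inj)/= -big_split/= mulr_sumr.
under eq_bigr => s _ do rewrite subSS W_moment_even -1?ltnS//.
rewrite -mulr_sumr.
pose G s := (-1) ^+ s * ebinom k w n s * sn k (w * s%:R).
rewrite -(big_mkord xpredT (fun s => G s - G s.+1)).
rewrite (eq_bigr (fun s => - (G s.+1 - G s))); last by move=> s _; rewrite opprB.
rewrite sumrN telescope_sumr// /G /ebinom ltnn mulr0 mul0r.
by rewrite mulr0 sn0 mulr0 subrr oppr0 mulr0.
Qed.

End jacobi.

Lemma sigma_Phi (R : realType) (k w : R) n :
  sigma k w (Phi k w n) = (\sum_(s < n.+1) W k w n s * moment k w s%:Z)%:C.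
Proof.
rewrite /Phi linear_sum rmorph_sum; apply: eq_bigr => s _.
by rewrite linearZ/= moment_functional_zpow rmorphM.
Qed.

Theorem proposition4 (R : realType) (k w : R) (hk0 : 0 < k) (hk1 : k < 1)
    (hw : irrational (w / ellipticK k)) :
  forall n : nat, (1 <= n)%N ->
    sigma k w (Phi k w n)
      = (\sum_(s < n.+1) W k w n s * moment k w s%:Z)%:C
    /\ \sum_(s < n.+1) W k w n s * moment k w s%:Z = 0.
Proof.
move=> n n0; split; first exact: sigma_Phi.
have a_neq0 m : (0 < m)%N -> sn k (w * m%:R) != 0.
  exact: sn_lattice_neq0 hw.
have [on|en] := boolP (odd n); first exact: sum_odd.
exact: sum_even.
Qed.
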